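(* Let $H$ be a Hopf algebra over a field of characteristic $0$, and let $L$ be a finite-dimensional Lie algebra over that field which is a right $H$-comodule, or a left $H$-module, with $H$-coinvariant, respectively $H$-invariant, bracket. If the nilradical $\mathfrak{n}(L)$ is $H$-(co)invariant, then so is the solvable radical $\mathfrak{r}(L)$.
   Context: The bracket is $H$-(co)invariant if $[-,-]:L\otimes L\to L$ is a morphism of $H$-(co)modules, $L\otimes L$ carrying the usual diagonal (co)action. The nilradical $\mathfrak{n}(L)$ is the largest nilpotent ideal of $L$ and the solvable radical $\mathfrak{r}(L)$ is the largest solvable ideal. A subspace $W\le L$ is $H$-invariant (module case) if $H\cdot W\subseteq W$, respectively $H$-coinvariant (comodule case) if the coaction $\rho:L\to L\otimes H$ satisfies $\rho(W)\subseteq W\otimes H$. *)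

(* Defs.v *)
From HB Require Import structures.
From mathcomp Require Import all_boot all_order all_algebra.
From mathcomp Require Import boolp.
From mathcomp.multinomials Require Import freeg.

Set Implicit Arguments.
Unset Strict Implicit.
Unset Printing Implicit Defensive.

Import GRing.Theory.
Local Open Scope ring_scope.
Local Open Scope quotient_scope.

(* MathComp has no tensor product of possibly infinite-dimensional spaces.    *)
(* It is built here as the free module on V * W modulo the submodule          *)
(* generated by the bilinearity relations.                                    *)

Section TensorDef.
Variables (K : fieldType) (V W : lmodType K).

Definition free_pair (v : V) (w : W) : {freeg (V * W)%type / K} :=
  Freeg [:: (1, (v, w))].

Inductive tens_rel : {freeg (V * W)%type / K} -> Prop :=
| tens_rel0 : tens_rel 0
| tens_relD x y : tens_rel x -> tens_rel y -> tens_rel (x + y)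
| tens_relZ c x : tens_rel x -> tens_rel (c *: x)
| tens_rel_addl v v' w :
    tens_rel (free_pair (v + v') w - free_pair v w - free_pair v' w)
| tens_rel_addr v w w' :
    tens_rel (free_pair v (w + w') - free_pair v w - free_pair v w')
| tens_rel_scalel c v w : tens_rel (free_pair (c *: v) w - c *: free_pair v w)
| tens_rel_scaler c v w : tens_rel (free_pair v (c *: w) - c *: free_pair v w).

Definition tens_relb : {pred {freeg (V * W)%type / K}} :=
  fun x => `[< tens_rel x >].

Fact tens_relb_zmod_closed : zmod_closed tens_relb.
Proof.
split=> [|x y]; first by apply/asboolP; exact: tens_rel0.
move=> /asboolP xR /asboolP yR; apply/asboolP; rewrite -scaleN1r.
by apply: tens_relD => //; exact: tens_relZ.
Qed.

HB.instance Definition _ :=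
  GRing.isZmodClosed.Build _ tens_relb tens_relb_zmod_closed.

Definition tens : Type := Quotient.quot (tens_relb : zmodClosed {freeg (V * W)%type / K}).

HB.instance Definition _ := GRing.Zmodule.on tens.
HB.instance Definition _ := Quotient.on tens.

Lemma tens_eqP (x y : {freeg (V * W)%type / K}) :
  \pi_tens x = \pi_tens y <-> tens_rel (x - y).
Proof.
have E := Quotient.idealrBE (tens_relb : zmodClosed _) x y.
split=> [/eqP|] h; last by apply/eqP; rewrite -E; apply/asboolP.
by move: h; rewrite -E => /asboolP.
Qed.

Lemma pi_tensD (x y : {freeg (V * W)%type / K}) :
  \pi_tens (x + y) = \pi_tens x + \pi_tens y.
Proof. exact: (Quotient.pi_add (tens_relb : zmodClosed {freeg (V * W)%type / K})). Qed.

Definition tens_scale (c : K) (t : tens) : tens := \pi_tens (c *: repr t).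

Lemma pi_tens_scale c (x : {freeg (V * W)%type / K}) :
  tens_scale c (\pi_tens x) = \pi_tens (c *: x).
Proof.
apply/tens_eqP; rewrite -scalerBr; apply: tens_relZ; apply/tens_eqP.
exact: reprK.
Qed.

Fact tens_scaleA a b t : tens_scale a (tens_scale b t) = tens_scale (a * b) t.
Proof.
by elim/quotW: t => x; rewrite (pi_tens_scale b) !pi_tens_scale scalerA.
Qed.

Fact tens_scale1 : left_id 1 tens_scale.
Proof. by elim/quotW => x; rewrite pi_tens_scale scale1r. Qed.

Fact tens_scaleDr : right_distributive tens_scale +%R.
Proof.
move=> c; elim/quotW => x; elim/quotW => y.
by rewrite -pi_tensD !pi_tens_scale scalerDr pi_tensD.
Qed.

Fact tens_scaleDl t : {morph tens_scale^~ t : a b / a + b}.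
Proof.
by elim/quotW: t => x a b; rewrite !pi_tens_scale scalerDl pi_tensD.
Qed.

HB.instance Definition _ := GRing.Zmodule_isLmodule.Build K tens
  tens_scaleA tens_scale1 tens_scaleDr tens_scaleDl.

Lemma pi_tensZ c (x : {freeg (V * W)%type / K}) :
  \pi_tens (c *: x) = c *: \pi_tens x.
Proof. by rewrite -pi_tens_scale. Qed.

Definition tpure (v : V) (w : W) : tens := \pi_tens (free_pair v w).

(* Total in f, but only meaningful when f is bilinear: then it is the unique  *)
(* linear map induced by f (tlift_is_linear, tlift_pure, tens_eq_linear).     *)
Definition tlift (U : lmodType K) (f : V -> W -> U) (t : tens) : U :=
  fglift (fun p => f p.1 p.2) (repr t).

Lemma tpureDl v v' w : tpure (v + v') w = tpure v w + tpure v' w.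
Proof.
rewrite /tpure -pi_tensD; apply/tens_eqP; rewrite opprD addrA.
exact: tens_rel_addl.
Qed.

Lemma tpureDr v w w' : tpure v (w + w') = tpure v w + tpure v w'.
Proof.
rewrite /tpure -pi_tensD; apply/tens_eqP; rewrite opprD addrA.
exact: tens_rel_addr.
Qed.

Lemma tpureZl c v w : tpure (c *: v) w = c *: tpure v w.
Proof. by rewrite /tpure -pi_tensZ; apply/tens_eqP; exact: tens_rel_scalel. Qed.

Lemma tpureZr c v w : tpure v (c *: w) = c *: tpure v w.
Proof. by rewrite /tpure -pi_tensZ; apply/tens_eqP; exact: tens_rel_scaler. Qed.

Lemma tens_sumP (t : tens) :
  exists s : seq (V * W), t = \sum_(p <- s) tpure p.1 p.2.
Proof.
rewrite -[t]reprK -[repr t]freeg_sumE; move: (repr t) => x.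
exists [seq (coeff z x *: z.1, z.2) | z <- dom x].
elim: (dom x) => [|z s IH].
  by rewrite !big_nil; apply/esym; have := pi_tensZ 0 0; rewrite !scale0r.
rewrite map_cons !big_cons pi_tensD IH tpureZl -pi_tensZ.
congr (\pi_tens _ + _); apply/eqP/freeg_eqP=> u.
by rewrite coeffZ !coeffU mul1r -surjective_pairing.
Qed.

Lemma tens_eq_linear (U : lmodType K) (f g : {linear tens -> U}) :
  (forall v w, f (tpure v w) = g (tpure v w)) -> f =1 g.
Proof.
move=> fg t; have [s ->] := tens_sumP t.
by rewrite !linear_sum; apply: eq_bigr => p _; exact: fg.
Qed.

Section Lift.
Variables (U : lmodType K) (f : V -> W -> U).

Let F : {freeg (V * W)%type / K} -> U := fglift (fun p => f p.1 p.2).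

Let FB : {morph F : x y / x - y}.
Proof. exact: lift_is_additive. Qed.

Let F0 : F 0 = 0. Proof. by rewrite -[0](subrr 0) FB subrr. Qed.

Let FD : {morph F : x y / x + y}.
Proof.
move=> x y; have -> : x + y = x - (0 - y) by rewrite sub0r opprK.
by rewrite !FB F0 sub0r opprK.
Qed.

Let FZ c : {morph F : x / c *: x}.
Proof.
have Fsum (r : seq (V * W)) G : F (\sum_(z <- r) G z) = \sum_(z <- r) F (G z).
  by elim: r => [|z r IH]; rewrite ?big_nil // !big_cons FD IH.
have scaleU k z : c *: Freeg [:: (k, z)] = Freeg [:: (c * k, z)].
  by apply/eqP/freeg_eqP=> u; rewrite coeffZ !coeffU mulrA.
move=> x; rewrite -[x]freeg_sumE scaler_sumr !Fsum scaler_sumr.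
by apply: eq_bigr => z _; rewrite scaleU /F !liftU scalerA.
Qed.

Hypotheses (fl : forall w, linear (f^~ w)) (fr : forall v, linear (f v)).

Let F_rel x : tens_rel x -> F x = 0.
Proof.
have Fp v w : F (free_pair v w) = f v w by rewrite /F liftU scale1r.
have fDl v v' w : f (v + v') w = f v w + f v' w.
  by have := fl w 1 v v'; rewrite !scale1r.
have fDr v w w' : f v (w + w') = f v w + f v w'.
  by have := fr v 1 w w'; rewrite !scale1r.
have fZl c v w : f (c *: v) w = c *: f v w.
  exact: (scalable_linear (fl w)).
have fZr c v w : f v (c *: w) = c *: f v w.
  exact: (scalable_linear (fr v)).
elim=> {x} [|x y _ Fx _ Fy|c x _ Fx|v v' w|v w w'|c v w|c v w].
- exact: F0.
- by rewrite FD Fx Fy addr0.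
- by rewrite FZ Fx scaler0.
- by rewrite !FB !Fp fDl addrAC addrK subrr.
- by rewrite !FB !Fp fDr addrAC addrK subrr.
- by rewrite FB FZ !Fp fZl subrr.
- by rewrite FB FZ !Fp fZr subrr.
Qed.

Let tlift_pi x : tlift f (\pi_tens x) = F x.
Proof.
apply/eqP; rewrite -subr_eq0 -FB; apply/eqP/F_rel/tens_eqP; exact: reprK.
Qed.

Lemma tlift_pure v w : tlift f (tpure v w) = f v w.
Proof. by rewrite tlift_pi /F liftU scale1r. Qed.

Lemma tlift_is_linear : linear (tlift f).
Proof.
move=> c; elim/quotW => x; elim/quotW => y.
rewrite -pi_tensZ -pi_tensD !tlift_pi.
by rewrite FD FZ.
Qed.

End Lift.

End TensorDef.

Notation "V ⊗ W" := (tens V W) (at level 40, left associativity).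
Notation "v :⊗ w" := (tpure v w) (at level 40, left associativity) : ring_scope.

Section TensorMaps.
Variable K : fieldType.

Definition tmap (V V' W W' : lmodType K) (f : V -> V') (g : W -> W') :
    V ⊗ W -> V' ⊗ W' :=
  tlift (fun v w => f v :⊗ g w).

Definition tassoc (U V W : lmodType K) : (U ⊗ V) ⊗ W -> U ⊗ (V ⊗ W) :=
  tlift (fun t w => tlift (fun u v => u :⊗ (v :⊗ w)) t).

Definition tmul (A B : algType K) (s t : A ⊗ B) : A ⊗ B :=
  tlift (fun a b => tlift (fun c d => (a * c) :⊗ (b * d)) t) s.

End TensorMaps.

HB.mixin Record Algebra_isHopf (K : fieldType) H of GRing.Algebra K H := {
  comul : {linear H -> H ⊗ H};
  counit : {linear H -> K^o};
  antipode : {linear H -> H};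
  comulA : forall h : H,
    tassoc (tmap comul id (comul h)) = tmap id comul (comul h);
  counitl : forall h : H, tlift (fun a b => counit a *: b) (comul h) = h;
  counitr : forall h : H, tlift (fun a b => counit b *: a) (comul h) = h;
  comul1 : comul 1 = 1 :⊗ 1;
  comulM : forall g h : H, comul (g * h) = tmul (comul g) (comul h);
  counit1 : counit 1 = 1;
  counitM : forall g h : H, counit (g * h) = counit g * counit h;
  antipodel : forall h : H,
    tlift (fun a b => antipode a * b) (comul h) = (counit h : K)%:A;
  antipoder : forall h : H,
    tlift (fun a b => a * antipode b) (comul h) = (counit h : K)%:A
}.

#[short(type="hopfAlgType")]
HB.structure Definition Hopf (K : fieldType) :=
  {H of GRing.Algebra K H & Algebra_isHopf K H}.

Section Modules.
Variables (K : fieldType) (H : hopfAlgType K).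

Definition is_left_module (V : lmodType K) (act : {bilinear H -> V -> V}) :=
  (forall v, act 1 v = v) /\ (forall g h v, act (g * h) v = act g (act h v)).

Definition is_right_comodule (V : lmodType K) (rho : {linear V -> V ⊗ H}) :=
  (forall v, tassoc (tmap rho id (rho v)) = tmap id comul (rho v)) /\
  (forall v, tlift (fun (x : V) (h : H) => counit h *: x) (rho v) = v).

Definition module_morphism (V W : lmodType K)
    (actV : H -> V -> V) (actW : H -> W -> W) (f : V -> W) :=
  forall h v, f (actV h v) = actW h (f v).

Definition comodule_morphism (V W : lmodType K)
    (rhoV : V -> V ⊗ H) (rhoW : W -> W ⊗ H) (f : V -> W) :=
  forall v, rhoW (f v) = tmap f id (rhoV v).

(* h . (x :⊗ y) = h_(1) x :⊗ h_(2) y *)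
Definition diag_act (V W : lmodType K) (actV : H -> V -> V) (actW : H -> W -> W)
    (h : H) (t : V ⊗ W) : V ⊗ W :=
  tlift (fun h1 h2 => tmap (actV h1) (actW h2) t) (comul h).

(* x :⊗ y |-> (x_(0) :⊗ y_(0)) :⊗ x_(1) y_(1) *)
Definition diag_coact (V W : lmodType K)
    (rhoV : V -> V ⊗ H) (rhoW : W -> W ⊗ H) : V ⊗ W -> (V ⊗ W) ⊗ H :=
  tlift (fun x y =>
    tlift (fun x0 x1 =>
      tlift (fun y0 y1 => (x0 :⊗ y0) :⊗ (x1 * y1)) (rhoW y)) (rhoV x)).

Variable L : vectType K.

Definition invariant_bracket (br : L -> L -> L) (act : H -> L -> L) :=
  module_morphism (diag_act act act) act (tlift br).

Definition coinvariant_bracket (br : L -> L -> L) (rho : L -> L ⊗ H) :=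
  comodule_morphism (diag_coact rho rho) rho (tlift br).

Definition H_invariant (act : H -> L -> L) (W : {vspace L}) :=
  forall h w, w \in W -> act h w \in W.

(* rho(W) is contained in the image of W ⊗ H in L ⊗ H *)
Definition H_coinvariant (rho : L -> L ⊗ H) (W : {vspace L}) :=
  forall w, w \in W -> exists t : subvs_of W ⊗ H, rho w = tmap vsval id t.

End Modules.

Section LieAlgebra.
Variables (K : fieldType) (L : vectType K) (br : L -> L -> L).

Definition is_lie_bracket :=
  (forall x, br x x = 0) /\
  (forall x y z, br x (br y z) + br y (br z x) + br z (br x y) = 0).

Definition lie_ideal (I : {vspace L}) := forall x y, y \in I -> br x y \in I.

(* [U, V], the span of the brackets of elements of U with elements of V *)
Definition lie_prod (U V : {vspace L}) : {vspace L} :=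
  span (allpairs br (vbasis U) (vbasis V)).

Definition lower_central (I : {vspace L}) (k : nat) : {vspace L} :=
  iter k (lie_prod I) I.

Definition derived_series (I : {vspace L}) (k : nat) : {vspace L} :=
  iter k (fun J => lie_prod J J) I.

Definition lie_nilpotent (I : {vspace L}) :=
  exists k, lower_central I k = 0%VS.

Definition lie_solvable (I : {vspace L}) :=
  exists k, derived_series I k = 0%VS.

Definition is_nilradical (N : {vspace L}) :=
  [/\ lie_ideal N, lie_nilpotent N &
      forall I, lie_ideal I -> lie_nilpotent I -> (I <= N)%VS].

Definition is_solvable_radical (R : {vspace L}) :=
  [/\ lie_ideal R, lie_solvable R &
      forall I, lie_ideal I -> lie_solvable I -> (I <= R)%VS].

End LieAlgebra.

(* Main.v *)
From HB Require Import structures.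
Require Import Defs.
From mathcomp Require Import all_boot all_order all_algebra.
From mathcomp Require Import boolp.

(** Why the theorem holds.  In characteristic 0 the solvable radical is
    determined by the nilradical and the bracket alone:

      R = { x | [x, y] \in N for all y }          (mem_solvable_radical).

    Once this is known, the Hopf algebra enters only through two identities
    that move the action, or coaction, from a bracket to its left entry,

      [h x, y]        = h_(1) [x, S(h_(2)) y]                 (act_bracket)
      [x_(0), y] (x) x_(1) = [x, y_(0)]_(0) (x) [x, y_(0)]_(1) S(y_(1))
                                                              (coact_bracket).

    If x is in R, the brackets on the right lie in the invariant space N, hence
    so do the left-hand sides, and the description of R says that h x is in R,
    respectively that the left-hand factors of the coaction of x are in R.  In
    the second case one still has to pass from the vanishing of finitely many
    maps f_i (x) id on a tensor to membership in (cap_i ker f_i) (x) H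
    (tens_subvsP).

    For the description of R, the space { x | [x, L] <= N } is an ideal whose
    derived algebra is inside the nilpotent N, so it is solvable.  The converse
    says that [L, R] is a nilpotent ideal.  The usual road through Lie's theorem
    needs an algebraically closed field; here it is replaced by an argument with
    traces that works over every field of characteristic 0 and needs neither
    quotients nor composition series.

    Let rho be a representation of L by n x n matrices, A the associative algebra
    generated by the image, and for a subalgebra B let its trace radical be
    { a in B | tr(a b) = 0 for b in B }.  Its elements are nilpotent, because a
    matrix all of whose positive powers have trace 0 is nilpotent
    (trace_exp_nilmx).  Let J be the trace radical of A.  Two facts about J carry
    the proof.

    - A set Q of nilpotent matrices of A that is a (non unital) algebra and is
      stable under commutation with rho(L) lies in J (stable_nil_env_rad): some
      power of Q is 0, and the flag of the vectors killed by the powers of Q is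
      stable under A, so that q b is nilpotent for q in Q and b in A.
    - If F is an ideal, D lies in [L, F] and rho[D, F] lies in J, then rho(D) lies
      in J (env_rad_of_comm): the trace radical of the centraliser of rho(F)
      modulo J is such a Q, and it contains rho(D) since
      tr([x, f] c) = tr(x [f, c]) and [f, c] is in J.

    Descending along the derived series D_k of R, two applications of the second
    fact lead from rho[L, D_(k+1)] <= J to rho[L, D_k] <= J, hence finally to
    rho[L, R] <= J (radical_env_rad).  For the adjoint representation this gives
    the nilpotency of [L, R], as some power of J is 0. *)

Set Implicit Arguments.
Unset Strict Implicit.
Unset Printing Implicit Defensive.

Import GRing.Theory.
Local Open Scope ring_scope.

(** * Linearly closed predicates *)

(** Algebras of matrices and their radicals are handled as predicates; a
    subspace is extracted from them, by [lin_closed_vspace], only where a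
    dimension is needed. *)
Definition lin_closed (K : fieldType) (V : lmodType K) (P : V -> Prop) :=
  P 0 /\ forall a u v, P u -> P v -> P (a *: u + v).

Section LinClosed.
Variables (K : fieldType) (V : lmodType K) (P : V -> Prop).
Hypothesis linP : lin_closed P.

Lemma lin_closedZ a u : P u -> P (a *: u).
Proof. by move=> Pu; rewrite -[_ *: _]addr0; apply: linP.2 => //; exact: linP.1. Qed.

Lemma lin_closedD u v : P u -> P v -> P (u + v).
Proof. by move=> Pu Pv; rewrite -[u]scale1r; apply: linP.2. Qed.

Lemma lin_closedN u : P u -> P (- u).
Proof. by rewrite -scaleN1r; apply: lin_closedZ. Qed.

Lemma lin_closedB u v : P u -> P v -> P (u - v).
Proof. by move=> Pu Pv; apply: lin_closedD => //; apply: lin_closedN. Qed.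

Lemma lin_closed_sum (I : Type) (r : seq I) (F : I -> V) :
  (forall i, P (F i)) -> P (\sum_(i <- r) F i).
Proof. by move=> PF; apply: big_ind => //; [exact: linP.1 | exact: lin_closedD]. Qed.

End LinClosed.

(** A subspace of maximal dimension among those contained in the predicate
    must contain every vector that satisfies it. *)
Lemma lin_closed_vspace (K : fieldType) (V : vectType K) (P : V -> Prop) :
  lin_closed P -> exists W : {vspace V}, forall v, v \in W <-> P v.
Proof.
move=> linP.
pose good d := `[< exists2 W : {vspace V}, (forall v, v \in W -> P v) & \dim W = d >].
have ex : exists d, good d.
  exists 0%N; apply/asboolP; exists 0%VS; last exact: dimv0.
  by move=> v; rewrite memv0 => /eqP ->; exact: linP.1.
have ub d : good d -> (d <= \dim {:V})%N.
  by case/asboolP=> W _ <-; apply/dimvS/subvf.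
case: (ex_maxnP ex ub) => d /asboolP[W WP dW] maxd.
exists W => v; split=> [/WP//|Pv].
have := maxd (\dim (W + <[v]>)); rewrite -dW => dWv.
have : (\dim (W + <[v]>) <= \dim W)%N.
  apply: dWv; apply/asboolP; exists (W + <[v]>)%VS => // u.
  case/memv_addP=> w wW [_ /vlineP[a ->] ->]; apply: lin_closedD (WP _ wW) _ => //.
  exact: lin_closedZ.
rewrite (geq_leqif (dimv_leqif_sup (addvSl W <[v]>))) => /subvP->//.
by apply: (subvP (addvSr W <[v]>)); exact: memv_line.
Qed.

(** * Algebras of nilpotent matrices *)

Section NilMatrices.
Variables (K : fieldType) (n : nat).
Implicit Types (Q : 'M[K]_n -> Prop) (v : 'rV[K]_n).

(** The flag attached to [Q]: the vectors on which every product of [k] elements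
    of [Q] vanishes, for the right action on row vectors. *)
Fixpoint killed Q k v :=
  if k is k'.+1 then forall q, Q q -> killed Q k' (v *m q) else v = 0.

Lemma killed_lin Q k : lin_closed (killed Q k).
Proof.
elim: k => [|k [IH0 IH]]; split=> //=.
- by move=> a u v -> ->; rewrite scaler0 addr0.
- by move=> q _; rewrite mul0mx.
- by move=> a u v Hu Hv q Qq; rewrite mulmxDl -scalemxAl; apply: IH; [exact: Hu|exact: Hv].
Qed.

Lemma killedS Q k v : killed Q k v -> killed Q k.+1 v.
Proof.
elim: k v => [|k IH] v /=; first by move=> -> q _; rewrite mul0mx.
by move=> Hv q Qq; apply: IH; apply: Hv.
Qed.

Lemma killed_leq Q k l v : (k <= l)%N -> killed Q k v -> killed Q l v.
Proof. by move=> /subnK <-; elim: (l - k)%N => // m IH /IH; apply: killedS. Qed.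

Definition nilmx (a : 'M[K]_n) := exists m, a ^+ m = 0.

Lemma killed_uniform Q (W : {vspace 'rV[K]_n}) :
  (forall w, w \in W -> exists k, killed Q k w) ->
  exists k, forall w, w \in W -> killed Q k w.
Proof.
move=> HW; have /choice[f Hf] : forall i : 'I_(\dim W), exists k, killed Q k (vbasis W)`_i.
  by move=> i; apply/HW/vbasis_mem/mem_nth; rewrite size_tuple.
exists (\max_i f i)%N => w /coord_vbasis ->.
apply: lin_closed_sum; first exact: killed_lin.
move=> i; apply: lin_closedZ; first exact: killed_lin.
by apply: killed_leq (Hf i); exact: leq_bigmax.
Qed.

(** An algebra [Q] of nilpotent matrices is nilpotent.  By induction on the
    dimension of [v Q]: for [w] in [v Q] one has [w Q <= v Q], and equality
    would give [w = w r] with [r] in [Q], hence [w = w r^m = 0]. *)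
Lemma nil_killed Q : lin_closed Q -> (forall a b, Q a -> Q b -> Q (a *m b)) ->
  (forall a, Q a -> nilmx a) -> exists k, forall v, killed Q k v.
Proof.
move=> linQ mulQ nilQ.
suff pw v : exists k, killed Q k v.
  have [k Hk] := @killed_uniform Q fullv (fun w _ => pw w).
  by exists k => v; apply: Hk; rewrite memvf.
have img u : exists W : {vspace 'rV[K]_n}, forall w, w \in W <-> exists2 q, Q q & w = u *m q.
  apply: lin_closed_vspace; split; first by exists 0; [exact: linQ.1|rewrite mulmx0].
  move=> a _ _ [q Qq ->] [r Qr ->]; exists (a *: q + r); first exact: linQ.2.
  by rewrite mulmxDr -scalemxAr.
have [d] := ubnP (\dim (projT1 (cid (img v)))).
elim: d v => // d IH v; case: cid => /= W WP; rewrite ltnS => dW.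
have : exists k, forall w, w \in W -> killed Q k w; last first.
  by case=> k Hk; exists k.+1 => q Qq /=; apply/Hk/WP; exists q.
apply: killed_uniform => w wW.
have /WP[q Qq wE] := wW.
case: (cid (img w)) (IH w) => /= W' W'P IHw.
have sW : (W' <= W)%VS.
  apply/subvP=> u /W'P[r Qr ->]; apply/WP; exists (q *m r); first exact: mulQ.
  by rewrite wE mulmxA.
have [wW'|wW'] := boolP (w \in W').
  have /W'P[r Qr wr] := wW'.
  have [m rm] := nilQ _ Qr.
  exists 0%N => /=.
  have E j : w = w *m (r ^+ j).
    elim: j => [|j {1}->]; first by rewrite expr0 mulmx1.
    by rewrite {1}wr -mulmxA exprS.
  by rewrite (E m) rm mulmx0.
apply: IHw; apply: leq_trans dW.
rewrite ltn_neqAle dimvS // andbT.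
by apply: contra wW' => /eqP dE; have /eqP -> : W' == W by rewrite eqEdim sW dE leqnn.
Qed.

End NilMatrices.

(** * Traces and nilpotency in characteristic 0 *)

Section TraceNilpotent.
Variables (K : fieldType) (charK : [pchar K] =i pred0).

(** With [e = C R] the rank factorisation, idempotency reads [R C = 1], and
    [tr (C R) = tr (R C)]. *)
Lemma mxtrace_idem n (e : 'M[K]_n) : e *m e = e -> \tr e = (\rank e)%:R.
Proof.
move=> ee.
have RC : row_base e *m col_base e = 1%:M.
  apply: (row_free_inj (row_base_free e)).
  apply: (row_full_inj (col_base_full e)); rewrite mul1mx.
  by have := ee; rewrite -{1 2 3}[e]mulmx_base -!mulmxA => ->.
have -> : \tr e = \tr (col_base e *m row_base e) by rewrite mulmx_base.
by rewrite mxtrace_mulC RC mxtrace1.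
Qed.

(** The projection [e] on the Fitting component where [a] is invertible is a
    polynomial in [a] without constant term, so it has trace 0; as its trace is
    its rank, it vanishes in characteristic 0. *)
Lemma trace_exp_nilmx n (a : 'M[K]_n) : (forall k, \tr (a ^+ k.+1) = 0) -> nilmx a.
Proof.
case: n a => [|n] a tra; first by exists 0%N; apply/matrixP=> -[].
have tr0 p m : \tr (horner_mx a p * a ^+ m.+1) = 0.
  rewrite -[p]coefK poly_def linear_sum mulr_suml linear_sum big1 //= => i _.
  by rewrite linearZ /= rmorphXn /= horner_mx_X -scalerAl -exprD addnS linearZ /= tra mulr0.
(* The characteristic polynomial is q X^m with q(0) = c != 0 and q = r X + c;
   Cayley-Hamilton then makes g a, with g = - r(a) / c, act as 1 on a^m. *)
have [m [q /implyP]] := multiplicity_XsubC (char_poly a) 0.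
rewrite -size_poly_eq0 size_char_poly => /(_ isT) q0 pE.
have [r rE] : exists r, q - q.[0]%:P = r * ('X - 0%:P).
  by apply/factor_theorem; rewrite rootE !hornerE subrr.
rewrite subr0 in rE; move/(congr1 (fun p => p + q.[0]%:P)): rE; rewrite subrK => qE.
set c := q.[0] in qE; have {}q0 : c != 0 by [].
pose g : 'M[K]_n.+1 := - c^-1 *: horner_mx a r.
have ag : GRing.comm a g.
  by rewrite /GRing.comm /g -scalerAr -scalerAl -{1 4}(horner_mx_X a) -!rmorphM mulrC.
have ag1 : a ^+ m = g * a * a ^+ m.
  have := Cayley_Hamilton a; rewrite pE subr0 qE rmorphM rmorphXn /= rmorphD rmorphM /=.
  rewrite horner_mx_C !horner_mx_X mulrDl => /eqP; rewrite addr_eq0 => /eqP E.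
  by rewrite /g -!scalerAl E scalerN scaleNr opprK -mulmxE mul_scalar_mx scalerA mulVf // scale1r.
(* One more power of a, so that the exponent is positive even when m = 0. *)
have ag2 : a ^+ m.+1 = g * a * a ^+ m.+1 by rewrite exprSr {1}ag1 -mulrA.
have gc : GRing.comm (g * a) a by rewrite /GRing.comm mulrA ag.
have ag3 k : a ^+ m.+1 = (g * a) ^+ k * a ^+ m.+1.
  by elim: k => [|k IH]; [rewrite mul1r | rewrite (exprSr (g * a)) -mulrA -ag2].
pose e := (g * a) ^+ m.+1.
have eE : e = g ^+ m.+1 * a ^+ m.+1 by apply/exprMn_comm/commr_sym.
have ee : e * e = e.
  have cg : GRing.comm e (g ^+ m.+1).
    by apply/commrX/commr_sym/commrX; rewrite /GRing.comm -mulrA ag.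
  by rewrite {2}eE mulrA cg -mulrA -ag3.
have gE : g ^+ m.+1 = horner_mx a ((- c^-1 *: r) ^+ m.+1).
  by rewrite rmorphXn /= linearZ.
have /eqP := mxtrace_idem ee.
rewrite {1}eE gE tr0 eq_sym; have /pcharf0P -> := charK.
rewrite mxrank_eq0 => /eqP e0.
by exists m.+1; rewrite (ag3 m.+1) -/e e0 mul0r.
Qed.

End TraceNilpotent.

(** By induction on the size: with [a = C R] the rank factorisation, [R C] is a
    nilpotent matrix of the same trace, and of smaller size unless [a] is
    invertible, which forces size 0. *)
Lemma nilmx_mxtrace (K : fieldType) n (a : 'M[K]_n) : nilmx a -> \tr a = 0.
Proof.
elim/ltn_ind: n a => n IH a [m am].
have [rn|] := ltnP (\rank a) n; last first.
  move=> nr; have an : a \in unitmx by rewrite -row_full_unit /row_full eqn_leq rank_leq_col.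
  have : a ^+ m \in unitmx.
    by elim: {am} m => [|m IHm]; rewrite ?expr0 ?unitmx1 // exprS unitmx_mul an.
  rewrite am -row_free_unit /row_free mxrank0 => /eqP n0.
  by rewrite /mxtrace big1 // => i _; have := ltn_ord i; rewrite -{2}n0.
have -> : \tr a = \tr (col_base a *m row_base a) by rewrite mulmx_base.
rewrite mxtrace_mulC; apply: IH => //; exists m.+1.
have E k : (row_base a *m col_base a) ^+ k.+1 = row_base a *m a ^+ k *m col_base a.
  elim: k => [|k IHk]; first by rewrite expr1 expr0 mulmx1.
  rewrite exprS IHk -mulmxE (exprS a).
  have -> : a * a ^+ k = (col_base a *m row_base a) *m a ^+ k by rewrite mulmx_base.
  by rewrite !mulmxA.
by rewrite E am mulmx0 mul0mx.
Qed.

(** * The trace radical of an algebra of matrices *)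

Section TraceRadical.
Variables (K : fieldType) (charK : [pchar K] =i pred0) (n : nat).
Implicit Types (B : 'M[K]_n -> Prop) (a b c : 'M[K]_n).

Definition subalg B :=
  [/\ lin_closed B, B 1%:M & forall a b, B a -> B b -> B (a *m b)].

Definition trace_rad B a := B a /\ forall b, B b -> \tr (a *m b) = 0.

Variable B : 'M[K]_n -> Prop.
Hypothesis subB : subalg B.

Lemma trace_rad_lin : lin_closed (trace_rad B).
Proof.
have [linB _ _] := subB.
split; first by split=> [|b _]; [exact: linB.1 | rewrite mul0mx mxtrace0].
move=> k a b [Ba Ta] [Bb Tb]; split=> [|c Bc]; first exact: linB.2.
by rewrite mulmxDl -scalemxAl linearD linearZ /= Ta // Tb // mulr0 addr0.
Qed.

Lemma trace_radMr a b : trace_rad B a -> B b -> trace_rad B (a *m b).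
Proof.
have [_ _ mulB] := subB; move=> [Ba Ta] Bb; split=> [|c Bc]; first exact: mulB.
by rewrite -mulmxA; apply/Ta/mulB.
Qed.

Lemma trace_radMl a b : trace_rad B a -> B b -> trace_rad B (b *m a).
Proof.
have [_ _ mulB] := subB; move=> [Ba Ta] Bb; split=> [|c Bc]; first exact: mulB.
by rewrite mxtrace_mulC mulmxA mxtrace_mulC; apply/Ta/mulB.
Qed.

(** The powers of an element of the radical are products of that element by
    elements of [B], hence have trace 0. *)
Lemma trace_rad_nilmx a : trace_rad B a -> nilmx a.
Proof.
have [_ B1 mulB] := subB; move=> [Ba Ta]; apply: trace_exp_nilmx => // k.
rewrite exprS; apply: Ta; elim: k => [|k IH]; first by rewrite expr0.
by rewrite exprS; apply: mulB.
Qed.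

End TraceRadical.

Definition mxcomm (K : fieldType) n (a b : 'M[K]_n) := a *m b - b *m a.

Section Commutator.
Variables (K : fieldType) (n : nat).
Implicit Types a b c : 'M[K]_n.

Lemma mxcommC a b : mxcomm a b = - mxcomm b a.
Proof. by rewrite /mxcomm opprB. Qed.

Lemma mxcommDl k a b c : mxcomm (k *: a + b) c = k *: mxcomm a c + mxcomm b c.
Proof.
by rewrite /mxcomm mulmxDl mulmxDr -scalemxAl -scalemxAr scalerBr opprD addrACA.
Qed.

Lemma mxcommMl a b c : mxcomm (a *m b) c = a *m mxcomm b c + mxcomm a c *m b.
Proof. by rewrite /mxcomm mulmxBr mulmxBl !mulmxA addrA subrK. Qed.

Lemma mxcomm_jacobi a b c :
  mxcomm (mxcomm a b) c = mxcomm a (mxcomm b c) - mxcomm b (mxcomm a c).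
Proof.
have -> : mxcomm a b = -1 *: (b *m a) + a *m b by rewrite scaleN1r addrC.
rewrite mxcommDl scaleN1r !mxcommMl /(mxcomm a (mxcomm b c)) /(mxcomm b (mxcomm a c)).
by rewrite opprB opprD addrC [X in _ + X = _]addrC addrACA.
Qed.

(** The invariance of the trace form. *)
Lemma mxtrace_comm a b c : \tr (mxcomm a b *m c) = \tr (a *m mxcomm b c).
Proof.
rewrite /mxcomm mulmxBl mulmxBr !linearB /= -[b *m a *m c]mulmxA.
by rewrite [\tr (b *m (a *m c))]mxtrace_mulC !mulmxA.
Qed.

End Commutator.

(** * Products of ideals in a Lie algebra *)

Section LieProducts.
Variables (K : fieldType) (L : vectType K) (br : {bilinear L -> L -> L}).
Implicit Types (U V I J W : {vspace L}).

Lemma mem_lie_prod U V u v : u \in U -> v \in V -> br u v \in lie_prod br U V.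
Proof.
move=> /coord_vbasis -> /coord_vbasis ->.
rewrite linear_sumlz; apply: memv_suml => i _; rewrite linear_sumr.
apply: memv_suml => j _; rewrite linearZl_LR linearZr_LR /= !memvZ //.
by apply/memv_span/allpairs_f; apply/mem_nth; rewrite size_tuple.
Qed.

Lemma lie_prod_ind U V (P : L -> Prop) : lin_closed P ->
  (forall u v, u \in U -> v \in V -> P (br u v)) ->
  forall w, w \in lie_prod br U V -> P w.
Proof.
move=> linP HP w /coord_span ->; apply: lin_closed_sum => // i.
apply: lin_closedZ => //.
have : (allpairs_tuple br (vbasis U) (vbasis V))`_i \in
    allpairs br (vbasis U) (vbasis V) by apply: mem_nth; rewrite size_tuple.
by case/allpairsP=> -[u v] /= [/vbasis_mem Uu /vbasis_mem Vv ->]; exact: HP.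
Qed.

Lemma lin_closed_vs W : lin_closed (fun x => x \in W).
Proof. by split; [exact: mem0v | move=> a u v Wu Wv; rewrite memvD ?memvZ]. Qed.

Lemma lie_prod_sub U V W : (forall u v, u \in U -> v \in V -> br u v \in W) ->
  (lie_prod br U V <= W)%VS.
Proof. by move=> H; apply/subvP; apply: lie_prod_ind H; exact: lin_closed_vs. Qed.

Lemma lie_prodS U U' V V' : (U <= U')%VS -> (V <= V')%VS ->
  (lie_prod br U V <= lie_prod br U' V')%VS.
Proof.
move=> /subvP UU' /subvP VV'; apply: lie_prod_sub => u v Uu Vv.
by apply: mem_lie_prod; [exact: UU' | exact: VV'].
Qed.

Hypothesis brL : is_lie_bracket br.

Lemma lie_skew x y : br x y = - br y x.
Proof.
have := brL.1 (x + y); rewrite linearDl !linearDr /= !brL.1 addr0 add0r.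
by move/eqP; rewrite addr_eq0 => /eqP.
Qed.

Lemma lie_leibniz x y z : br x (br y z) = br (br x y) z + br y (br x z).
Proof.
have := brL.2 x y z; rewrite [br z x]lie_skew [br z (br x y)]lie_skew linearNr.
by move/eqP; rewrite -addrA -opprD addr_eq0 opprK addrC => /eqP.
Qed.

Lemma lie_ideal_prod I J :
  lie_ideal br I -> lie_ideal br J -> lie_ideal br (lie_prod br I J).
Proof.
move=> idI idJ x; apply: lie_prod_ind => [|u v Iu Jv].
  split; first by rewrite linear0r mem0v.
  by move=> a u v Hu Hv; rewrite linearPr /= memvD ?memvZ.
by rewrite lie_leibniz memvD ?mem_lie_prod //; [exact: idI | exact: idJ].
Qed.

Lemma lie_ideal_derived I k : lie_ideal br I -> lie_ideal br (derived_series br I k).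
Proof. by move=> idI; elim: k => //= k IH; exact: lie_ideal_prod. Qed.

End LieProducts.

(** * Brackets with the solvable radical act by elements of the trace radical *)

Section Representation.
Variables (K : fieldType) (charK : [pchar K] =i pred0).
Variables (L : vectType K) (br : {bilinear L -> L -> L}).
Hypothesis brL : is_lie_bracket br.
Variables (n : nat) (rho : {linear L -> 'M[K]_n}).
Hypothesis rhoB : forall x y, rho (br x y) = mxcomm (rho x) (rho y).

Inductive env : 'M[K]_n -> Prop :=
| env_one : env 1%:M
| env_rho x : env (rho x)
| env_lin k a b : env a -> env b -> env (k *: a + b)
| env_mul a b : env a -> env b -> env (a *m b).

Lemma subalg_env : subalg env.
Proof.
split; [|exact: env_one|exact: env_mul].
by split; [rewrite -(linear0 rho); exact: env_rho | exact: env_lin].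
Qed.

Let linE := let: And3 l _ _ := subalg_env in l.

Lemma env_comm a b : env a -> env b -> env (mxcomm a b).
Proof. by move=> Ea Eb; apply: lin_closedB linE _ _ _ _; exact: env_mul. Qed.

Definition env_rad := trace_rad env.

Let linJ : lin_closed env_rad := trace_rad_lin subalg_env.

Lemma env_rad_comm a b : env_rad a -> env b -> env_rad (mxcomm a b).
Proof.
move=> Ja Eb; apply: (lin_closedB linJ).
  exact: trace_radMr subalg_env _ _ _ _.
exact: trace_radMl subalg_env _ _ _ _.
Qed.

(** Since [v x q = v [x, q] + v q x], the flag of [Q] is stable under the
    representation, hence under the whole enveloping algebra; a product [a b]
    with [a] in [Q] then lowers the flag and is nilpotent, so has trace 0. *)
Lemma stable_nil_env_rad (Q : 'M[K]_n -> Prop) : lin_closed Q ->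
  (forall a b, Q a -> Q b -> Q (a *m b)) -> (forall a, Q a -> nilmx a) ->
  (forall a, Q a -> env a) -> (forall x a, Q a -> Q (mxcomm (rho x) a)) ->
  forall a, Q a -> env_rad a.
Proof.
move=> linQ mulQ nilQ envQ stQ.
have killed_env b : env b -> forall k v, killed Q k v -> killed Q k (v *m b).
  elim=> {b} [|x|c a b _ IHa _ IHb|a b _ IHa _ IHb] k v.
  - by rewrite mulmx1.
  - elim: k v => [|k IH] v /=; first by move=> ->; rewrite mul0mx.
    move=> Hv q Qq.
    have -> : v *m rho x *m q = v *m mxcomm (rho x) q + v *m q *m rho x.
      by rewrite /mxcomm mulmxBr !mulmxA subrK.
    apply: lin_closedD; first exact: killed_lin.
      by apply/Hv/stQ.
    by apply/IH/Hv.
  - move=> Hv; rewrite mulmxDr -scalemxAr.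
    by apply: (killed_lin Q k).2; [exact: IHa | exact: IHb].
  - by move=> Hv; rewrite mulmxA; apply/IHb/IHa.
have [k Hk] := nil_killed linQ mulQ nilQ.
move=> a Qa; split=> [|b Eb]; first exact: envQ.
apply: nilmx_mxtrace; exists k.
suff E j v : killed Q j v -> v *m (a *m b) ^+ j = 0.
  by apply/row_matrixP=> i; rewrite rowE row0 E.
elim: j v => [|j IH] v; first by move=> /= ->; rewrite mul0mx.
by move=> Hv; rewrite exprS -mulmxE !mulmxA; apply: IH; apply: killed_env => //; exact: Hv.
Qed.

(** The centraliser of the image of [F] modulo the trace radical. *)
Definition central_mod (F : {vspace L}) a :=
  env a /\ forall f, f \in F -> env_rad (mxcomm a (rho f)).

Lemma subalg_central_mod F : subalg (central_mod F).
Proof.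
split.
- split=> [|k a b [Ea Ha] [Eb Hb]]; split.
  + exact: linE.1.
  + by move=> f _; rewrite /mxcomm mul0mx mulmx0 subrr; exact: linJ.1.
  + exact: linE.2.
  + by move=> f Ff; rewrite mxcommDl; apply: linJ.2; [exact: Ha|exact: Hb].
- split=> [|f _]; first exact: env_one.
  by rewrite /mxcomm mul1mx mulmx1 subrr; exact: linJ.1.
- move=> a b [Ea Ha] [Eb Hb]; split=> [|f Ff]; first exact: env_mul.
  rewrite mxcommMl; apply: (lin_closedD linJ).
    by apply: trace_radMl (Hb _ Ff) Ea; exact: subalg_env.
  by apply: trace_radMr (Ha _ Ff) Eb; exact: subalg_env.
Qed.

Lemma central_mod_stable F x a : lie_ideal br F ->
  central_mod F a -> central_mod F (mxcomm (rho x) a).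
Proof.
move=> idF [Ea Ha]; split=> [|f Ff]; first by apply: env_comm Ea; exact: env_rho.
rewrite mxcomm_jacobi -rhoB; apply: (lin_closedB linJ); last exact/Ha/idF.
rewrite mxcommC; apply: (lin_closedN linJ).
by apply: env_rad_comm (env_rho x); exact: Ha.
Qed.

(** The trace radical of the centraliser is an algebra of nilpotent matrices; it
    is stable under [rho] because [tr ([x, a] c) = - tr (a [x, c])]. *)
Lemma central_trace_rad F a : lie_ideal br F ->
  trace_rad (central_mod F) a -> env_rad a.
Proof.
move=> idF; have subB := subalg_central_mod F.
apply: stable_nil_env_rad => {a}.
- exact: trace_rad_lin.
- by move=> a b Qa [Bb _]; exact: trace_radMr.
- by move=> a; exact: trace_rad_nilmx.
- by move=> a [[]].
move=> x a [Ba Ta]; split=> [|c Bc]; first exact: central_mod_stable.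
rewrite mxcommC mulNmx linearN /= mxtrace_comm Ta ?oppr0 //.
exact: central_mod_stable.
Qed.

(** The elements of [rho D] centralise [rho F] modulo the trace radical, and they
    are sums of commutators [[rho x, rho f]], which are orthogonal to every [c]
    of that centraliser: [tr ([rho x, rho f] c) = tr (rho x [rho f, c])]. *)
Lemma env_rad_of_comm (F D : {vspace L}) : lie_ideal br F ->
  (D <= lie_prod br fullv F)%VS ->
  (forall d f, d \in D -> f \in F -> env_rad (rho (br d f))) ->
  forall d, d \in D -> env_rad (rho d).
Proof.
move=> idF /subvP DF HD d Dd; apply: (central_trace_rad idF).
split=> [|c [Ec Hc]].
  by split=> [|f Ff]; [exact: env_rho | rewrite -rhoB; exact: HD].
move: (DF d Dd); move: d {Dd}; apply: lie_prod_ind.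
  split=> [|k u v Hu Hv]; first by rewrite linear0 mul0mx mxtrace0.
  by rewrite linearP /= mulmxDl -scalemxAl linearD linearZ /= Hu Hv mulr0 addr0.
move=> x f _ Ff; rewrite rhoB mxtrace_comm mxtrace_mulC.
have [_ ->] // : env_rad (mxcomm (rho f) c).
  by rewrite mxcommC; apply/(lin_closedN linJ)/Hc.
exact: env_rho.
Qed.

(** Descending induction along the derived series [D]: if [[L, D_(j+1)]] acts in
    the trace radical, then so does [[D_(j+1), D_j]], hence [D_(j+1)], which
    contains [[[L, D_j], D_j]], hence [[L, D_j]]. *)
Lemma radical_env_rad (R : {vspace L}) : lie_ideal br R -> lie_solvable br R ->
  forall z, z \in lie_prod br fullv R -> env_rad (rho z).
Proof.
move=> idR [m Dm].
pose D := derived_series br R.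
have idD k : lie_ideal br (D k) := lie_ideal_derived brL idR (k := k).
suff : forall k, (k <= m)%N ->
    forall z, z \in lie_prod br fullv (D (m - k)%N) -> env_rad (rho z).
  by move=> /(_ m (leqnn m)); rewrite subnn.
elim=> [|k IH] km z.
  rewrite subn0 /D Dm; move: z; apply: lie_prod_ind.
    split=> [|c u v Hu Hv]; first by rewrite linear0; exact: linJ.1.
    by rewrite linearP; exact: linJ.2.
  by move=> u v _; rewrite memv0 => /eqP ->; rewrite !linear0r linear0; exact: linJ.1.
set j := (m - k.+1)%N.
have jE : (m - k)%N = j.+1 by rewrite subnSK.
rewrite jE in IH.
(* D_(j+1) = [D_j, D_j] is contained in [L, D_j]. *)
have HD1 d : d \in D j.+1 -> env_rad (rho d).
  apply: (env_rad_of_comm (idD j)) => {d} [|d f Dd Df].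
    exact/lie_prodS/subvv/subvf.
  rewrite lie_skew // linearN; apply: (lin_closedN linJ); apply: (IH (ltnW km)).
  by apply: mem_lie_prod => //; exact: memvf.
apply: (env_rad_of_comm (idD j)) => // d f Dd Df.
apply/HD1/mem_lie_prod => //.
by move: d Dd; apply/subvP/lie_prod_sub => u v _; exact: idD.
Qed.

End Representation.

(** * The adjoint representation and the description of the radical *)

Section Adjoint.
Import VectorInternalTheory.
Variables (K : fieldType) (L : vectType K) (br : {bilinear L -> L -> L}).

(** Matrices act on row vectors from the right, so it is [u |-> [u, x]], not
    [u |-> [x, u]], that defines a representation. *)
Definition adj_row (x : L) (v : 'rV[K]_(dim L)) : 'rV[K]_(dim L) :=
  v2r (br (r2v v) x).

Fact adj_row_linear x : linear (adj_row x).
Proof. by move=> a u v; rewrite /adj_row linearP linearPl /= linearP. Qed.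

HB.instance Definition _ x := GRing.isLinear.Build K _ _ _ (adj_row x) (adj_row_linear x).

Definition adj (x : L) : 'M[K]_(dim L) := lin1_mx (adj_row x).

Lemma mul_adj u x : v2r u *m adj x = v2r (br u x).
Proof. by rewrite mul_rV_lin1 /= /adj_row v2rK. Qed.

Lemma adj_eqP (a b : 'M[K]_(dim L)) : (forall u : L, v2r u *m a = v2r u *m b) -> a = b.
Proof. by move=> E; apply/row_matrixP=> i; rewrite !rowE -[delta_mx _ _]r2vK E. Qed.

Fact adj_linear : linear adj.
Proof.
move=> a x y; apply: adj_eqP => u.
by rewrite mulmxDr -scalemxAr !mul_adj linearPr /= linearP.
Qed.

HB.instance Definition _ := GRing.isLinear.Build K _ _ _ adj adj_linear.

Hypothesis brL : is_lie_bracket br.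

Lemma adj_br x y : adj (br x y) = mxcomm (adj x) (adj y).
Proof.
apply: adj_eqP => u; rewrite /mxcomm mulmxBr !mulmxA !mul_adj -linearB /=.
by congr v2r; rewrite (lie_leibniz brL) [br x (br u y)](lie_skew brL).
Qed.

Hypothesis charK : [pchar K] =i pred0.

(** [[L, R]] acts in the trace radical of the adjoint enveloping algebra, some
    power of which vanishes; each step of the lower central series of [[L, R]]
    goes one step down the corresponding flag. *)
Lemma lie_nilpotent_radical (R : {vspace L}) : lie_ideal br R -> lie_solvable br R ->
  lie_nilpotent br (lie_prod br fullv R).
Proof.
move=> idR solR; set I := lie_prod br fullv R.
have JI z : z \in I -> env_rad adj (adj z).
  exact: (radical_env_rad charK brL adj_br idR solR).
have subE := subalg_env adj.
have [k Hk] := @nil_killed _ _ (env_rad adj) (trace_rad_lin subE)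
  (fun a b Ja Jb => trace_radMr subE Ja Jb.1) (trace_rad_nilmx charK subE).
exists k; apply/eqP; rewrite -subv0; apply/subvP=> w wI.
rewrite memv0 -(inj_eq (can_inj v2rK)) linear0.
suff H j : (j <= k)%N -> forall w, w \in lower_central br I j ->
    killed (env_rad adj) (k - j) (v2r w).
  by apply/eqP; have := H k (leqnn k) w wI; rewrite subnn.
elim: j => [|j IH] jk {wI}w; first by move=> _; rewrite subn0; exact: Hk.
rewrite /lower_central iterS; move: w; apply: lie_prod_ind.
  have [H0 Hl] := killed_lin (env_rad adj) (k - j.+1).
  split=> [|a u v Hu Hv]; first by rewrite linear0.
  by rewrite linearP; exact: Hl.
move=> u v Iu /(IH (ltnW jk)); rewrite -subnSK //= => Hv.
rewrite (lie_skew brL) linearN /= -mul_adj; apply: lin_closedN; [exact: killed_lin | exact/Hv/JI].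
Qed.

Lemma derived_series_le (U V : {vspace L}) k : (U <= V)%VS ->
  (derived_series br U k <= derived_series br V k)%VS.
Proof. by move=> UV; elim: k => //= k IH; exact: lie_prodS. Qed.

Lemma lie_nilpotent_solvable (I : {vspace L}) : lie_ideal br I ->
  lie_nilpotent br I -> lie_solvable br I.
Proof.
move=> idI [k Ik]; exists k; apply/eqP; rewrite -subv0 -Ik.
elim: {Ik} k => //= k IH; apply: lie_prodS => //.
apply: subv_trans IH _; elim: k => //= k IH.
apply: lie_prod_sub => u v Iu /(subvP IH) Iv; exact: idI.
Qed.

(** From left to right, [[L, R]] is a nilpotent ideal.  From right to left, the
    [x] with [[x, L] <= N] form an ideal whose derived algebra lies in the
    nilpotent ideal [N], hence a solvable one. *)
Lemma mem_solvable_radical (N R : {vspace L}) :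
  is_nilradical br N -> is_solvable_radical br R ->
  forall x, x \in R <-> forall y, br x y \in N.
Proof.
move=> [idN nilN maxN] [idR solR maxR] x; split=> [Rx y|].
  rewrite (lie_skew brL) memvN.
  have /subvP-> // : (lie_prod br fullv R <= N)%VS.
    apply: maxN; last exact: lie_nilpotent_radical.
    by apply: lie_ideal_prod => // u v _; exact: memvf.
  by apply: mem_lie_prod => //; exact: memvf.
have [W WP] : exists W : {vspace L}, forall x, x \in W <-> forall y, br x y \in N.
  apply: lin_closed_vspace; split=> [y|a u v Hu Hv y]; first by rewrite linear0l mem0v.
  by rewrite linearPl /= memvD ?memvZ.
move/WP; apply/subvP/maxR.
  move=> z w /WP Ww; apply/WP=> y; rewrite (lie_skew brL); rewrite memvN; apply: idN.
  by rewrite (lie_skew brL) memvN.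
have [k Nk] := lie_nilpotent_solvable idN nilN.
exists k.+1; apply/eqP; rewrite -subv0 -Nk /derived_series iterSr.
apply: derived_series_le; apply: lie_prod_sub => u v /WP Wu _; exact: Wu.
Qed.

End Adjoint.

(** * Tensor calculus *)

(** The maps that occur below are nested abstractions without a canonical linear
    structure, so linearity is used as a property. *)
Section LinearPredicate.
Variables (K : fieldType) (V W : lmodType K) (f : V -> W).
Hypothesis lf : linear f.

Lemma linear_pred0 : f 0 = 0.
Proof. by have := lf (-1) 0 0; rewrite scaler0 addr0 scaleN1r addNr. Qed.

Lemma linear_predD u v : f (u + v) = f u + f v.
Proof. by have := lf 1 u v; rewrite !scale1r. Qed.

Lemma linear_predZ a v : f (a *: v) = a *: f v.
Proof. by have := lf a v 0; rewrite linear_pred0 !addr0. Qed.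

Lemma linear_predB u v : f (u - v) = f u - f v.
Proof. by rewrite linear_predD -scaleN1r linear_predZ scaleN1r. Qed.

Lemma linear_pred_sum (I : Type) (r : seq I) (F : I -> V) :
  f (\sum_(i <- r) F i) = \sum_(i <- r) f (F i).
Proof. exact: (big_morph f linear_predD linear_pred0). Qed.

End LinearPredicate.

Section TensorCalculus.
Variable K : fieldType.
Implicit Types U V W : lmodType K.

Definition bilin U V W (f : U -> V -> W) :=
  (forall v, linear (f^~ v)) /\ (forall u, linear (f u)).

Definition pure_sum V W (s : seq (V * W)) : V ⊗ W := \sum_(p <- s) p.1 :⊗ p.2.

Lemma tlift_linear U V W (f : U -> V -> W) : bilin f -> linear (tlift f).
Proof. by case=> fl fr; exact: tlift_is_linear. Qed.

Lemma tlift_sum U V W (f : U -> V -> W) s : bilin f ->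
  tlift f (pure_sum s) = \sum_(p <- s) f p.1 p.2.
Proof.
move=> bf; rewrite (linear_pred_sum (tlift_linear bf)); apply: eq_bigr => p _.
by case: bf => fl fr; exact: tlift_pure.
Qed.

Lemma bilin_tpure U U' V V' (f : U -> U') (g : V -> V') : linear f -> linear g ->
  bilin (fun u v => f u :⊗ g v).
Proof.
move=> lf lg; split=> [v|u] a x y; first by rewrite lf tpureDl tpureZl.
by rewrite lg tpureDr tpureZr.
Qed.

Lemma tpure_suml U V (I : Type) (r : seq I) (F : I -> U) (v : V) :
  (\sum_(i <- r) F i) :⊗ v = \sum_(i <- r) F i :⊗ v.
Proof.
by apply: (@linear_pred_sum _ _ _ (fun u => u :⊗ v)) => a x y; rewrite tpureDl tpureZl.
Qed.

Lemma tmap_linear U U' V V' (f : U -> U') (g : V -> V') : linear f -> linear g ->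
  linear (tmap f g).
Proof. by move=> lf lg; exact/tlift_linear/bilin_tpure. Qed.

Lemma tmap_sum U U' V V' (f : U -> U') (g : V -> V') s : linear f -> linear g ->
  tmap f g (pure_sum s) = \sum_(p <- s) f p.1 :⊗ g p.2.
Proof. by move=> lf lg; exact/tlift_sum/bilin_tpure. Qed.

Lemma tmap_pure U U' V V' (f : U -> U') (g : V -> V') u v : linear f -> linear g ->
  tmap f g (u :⊗ v) = f u :⊗ g v.
Proof. by move=> lf lg; have [? ?] := bilin_tpure lf lg; exact: tlift_pure. Qed.

Lemma linear_id {U} : linear (@id U). Proof. by []. Qed.

Lemma tassoc_sum U V W (s : seq ((U ⊗ V) * W)) :
  tassoc (pure_sum s) = \sum_(p <- s) tlift (fun u v => u :⊗ (v :⊗ p.2)) p.1.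
Proof.
apply: tlift_sum.
have bf (w : W) : bilin (fun (u : U) (v : V) => u :⊗ (v :⊗ w)).
  apply: (bilin_tpure (f := id) (g := fun v => v :⊗ w)) => //.
  by move=> a x y; rewrite tpureDl tpureZl.
split=> [w|t]; first exact: tlift_linear (bf w).
have [s' ->] := tens_sumP t; move=> a x y.
rewrite !tlift_sum // scaler_sumr -big_split /=; apply: eq_bigr => p _.
by rewrite tpureDr tpureZr tpureDr tpureZr.
Qed.

(** The left-hand side of coassociativity, in Sweedler's notation, with [c]
    selecting a representation of each [f u] as a sum of pure tensors. *)
Lemma tassoc_tmap_sum U U' V W (f : U -> U' ⊗ V) (c : U -> seq (U' * V)) (s : seq (U * W)) :
  linear f -> (forall u, f u = pure_sum (c u)) ->
  tassoc (tmap f id (pure_sum s)) =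
  \sum_(p <- s) \sum_(q <- c p.1) q.1 :⊗ (q.2 :⊗ p.2).
Proof.
move=> lf fE; rewrite tmap_sum //.
have -> : \sum_(p <- s) f p.1 :⊗ p.2 = pure_sum [seq (f p.1, p.2) | p <- s].
  by rewrite /pure_sum big_map.
rewrite tassoc_sum big_map; apply: eq_bigr => p _ /=; rewrite fE.
apply: tlift_sum.
apply: (bilin_tpure (f := id) (g := fun v => v :⊗ p.2)) => //.
by move=> a x y; rewrite tpureDl tpureZl.
Qed.

(** Let [F = (f_i)_i] and [G] a linear map with [F G F = F].  Then [id - G F] maps
    to the common kernel of the [f_i], and its complement [G F] factors through
    the [f_i], so that [id - G F], applied to the left factors, fixes [t]. *)
Lemma tens_subvsP (L : vectType K) (H : lmodType K) (I : finType)
    (f : I -> L -> L) (W : {vspace L}) (t : L ⊗ H) :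
  (forall i, linear (f i)) ->
  (forall x, (forall i, f i x = 0) -> x \in W) ->
  (forall i, tmap (f i) id t = 0) ->
  exists s : subvs_of W ⊗ H, t = tmap vsval id s.
Proof.
move=> lf HW; have [s ->] := tens_sumP t; rewrite -/(pure_sum s) => Ht.
have lF : linear (fun x => [ffun i => f i x]).
  by move=> a x y; apply/ffunP=> i; rewrite !ffunE lf.
pose Flin : {linear L -> {ffun I -> L}} :=
  HB.pack (fun x => [ffun i => f i x]) (GRing.isLinear.Build _ _ _ _ _ lF).
pose F := linfun Flin.
have FE x : F x = [ffun i => f i x] by rewrite lfunE.
pose inj i (y : L) : {ffun I -> L} := [ffun j => if j == i then y else 0].
pose e x := x - (F^-1)%VF (F x).
have eW x : e x \in W.
  apply: HW => i; rewrite (linear_predB (lf i)).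
  have /ffunP/(_ i) : F ((F^-1)%VF (F x)) = F x by apply/limg_lfunVK/memv_img/memvf.
  by rewrite !FE !ffunE => ->; rewrite subrr.
have FV x : (F^-1)%VF (F x) = \sum_i (F^-1)%VF (inj i (f i x)).
  rewrite -linear_sum; congr ((F^-1)%VF _); rewrite FE; apply/ffunP=> j.
  rewrite ffunE sum_ffunE (bigD1 j) //= ffunE eqxx big1 ?addr0 // => i ij.
  by rewrite ffunE eq_sym (negbTE ij).
exists (\sum_(p <- s) vsproj W (e p.1) :⊗ p.2).
have lv : linear (vsval : subvs_of W -> L) by exact: linearP.
rewrite (linear_pred_sum (tmap_linear lv linear_id)).
transitivity (\sum_(p <- s) e p.1 :⊗ p.2); last first.
  by apply: eq_bigr => p _; rewrite (tmap_pure _ _ lv linear_id) vsprojK.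
have eE p : p.1 :⊗ p.2 = e p.1 :⊗ p.2 + \sum_i (F^-1)%VF (inj i (f i p.1)) :⊗ p.2 :> L ⊗ H.
  by rewrite -tpure_suml -tpureDl -FV subrK.
rewrite /pure_sum (eq_bigr _ (fun p _ => eE p)) big_split /= exchange_big /=.
rewrite [X in _ + X]big1 ?addr0 // => i _.
pose g y := (F^-1)%VF (inj i y).
have lg : linear g.
  move=> a x y; rewrite /g -linearP; congr ((F^-1)%VF _); apply/ffunP=> j.
  by rewrite !ffunE; case: ifP => // _; rewrite scaler0 addr0.
have := congr1 (tmap g id) (Ht i).
rewrite (linear_pred0 (tmap_linear lg linear_id)) tmap_sum //.
rewrite (linear_pred_sum (tmap_linear lg linear_id)) => E; rewrite -[RHS]E.
by apply: eq_bigr => p _; rewrite tmap_pure.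
Qed.

End TensorCalculus.
Arguments linear_id {K U}.

(** * Moving the action off a bracket *)

Section HopfTranslation.
Variables (K : fieldType) (H : hopfAlgType K).
Variables (L : vectType K) (br : {bilinear L -> L -> L}).

Definition mul_antipode : H ⊗ H -> H := tlift (fun a b : H => a * antipode b).

Lemma bilin_mul_antipode : bilin (fun a b : H => a * antipode b).
Proof.
split=> [b|a] c x y; first by rewrite mulrDl scalerAl.
by rewrite linearP mulrDr scalerAr.
Qed.

Lemma mul_antipode_linear : linear mul_antipode.
Proof. exact: tlift_linear bilin_mul_antipode. Qed.

Lemma mul_antipode_pure a b : mul_antipode (a :⊗ b) = a * antipode b.
Proof. by have [? ?] := bilin_mul_antipode; exact: tlift_pure. Qed.

Lemma bilin_bracket : bilin (br : L -> L -> L).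
Proof. by split=> [v|u] a b c; rewrite ?linearPl ?linearPr. Qed.

Lemma bilin_act_bracket (act : {bilinear H -> L -> L}) x y :
  bilin (fun h t => br (act h x) (act (mul_antipode t) y)).
Proof.
split=> [t|h] c u v; first by rewrite !linearPl.
by rewrite mul_antipode_linear linearPl /= linearPr.
Qed.

(** Invariance of the bracket expands the right-hand side to
    [h_(1) x, h_(2) S(h_(3)) y]; the antipode and the counit collapse it. *)
Lemma act_bracket (act : {bilinear H -> L -> L}) :
  is_left_module act -> invariant_bracket br act ->
  forall h x y (s : seq (H * H)), comul h = pure_sum s ->
  br (act h x) y = \sum_(p <- s) act p.1 (br x (act (antipode p.2) y)).
Proof.
move=> [act1 actM] inv h x y s hs.
have bbr := bilin_bracket.
have [cop copE] := choice (fun h : H => tens_sumP (comul h)).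
have invE a z : act a (br x z) = \sum_(q <- cop a) br (act q.1 x) (act q.2 z).
  have := inv a (x :⊗ z); rewrite (tlift_pure bbr.1 bbr.2) => <-.
  rewrite /diag_act copE -/(pure_sum _) tlift_sum.
    rewrite (linear_pred_sum (tlift_linear bbr)); apply: eq_bigr => q _.
    rewrite tmap_pure; try exact: linearP.
    exact: (tlift_pure bbr.1 bbr.2).
  split=> [b|b] c u v.
    by rewrite !tmap_pure ?linearPl /= ?tpureDl ?tpureZl //; exact: linearP.
  by rewrite !tmap_pure ?linearPl /= ?tpureDr ?tpureZr //; exact: linearP.
have := comulA h; rewrite hs (tassoc_tmap_sum _ (linearP _) copE).
rewrite tmap_sum //; last exact: linearP.
move/(congr1 (tlift (fun h t => br (act h x) (act (mul_antipode t) y)))).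
have bF := bilin_act_bracket act x y.
rewrite !(linear_pred_sum (tlift_linear bF)).
under eq_bigr => p _.
  rewrite (linear_pred_sum (tlift_linear bF)).
  under eq_bigr => q _ do rewrite (tlift_pure bF.1 bF.2) mul_antipode_pure actM.
  rewrite -invE; over.
move=> ->.
under eq_bigr => p _ do rewrite (tlift_pure bF.1 bF.2)
  [mul_antipode _]antipoder linearZl_LR act1 /= linearZr_LR /= -linearZl_LR -linearZl_LR.
have := counitr h; rewrite hs tlift_sum.
  by move=> {1}<-; rewrite !linear_sumlz.
split=> [b|a] c u v; first by rewrite scalerDr !scalerA mulrC.
by rewrite linearP scalerDl scalerA.
Qed.

Lemma tmap_comp (U U' U'' V V' V'' : lmodType K) (f : U' -> U'') (g : V' -> V'')
    (f' : U -> U') (g' : V -> V') t :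
  linear f -> linear g -> linear f' -> linear g' ->
  tmap f g (tmap f' g' t) = tmap (f \o f') (g \o g') t.
Proof.
move=> lf lg lf' lg'; have [s ->] := tens_sumP t; rewrite -/(pure_sum s).
rewrite (tmap_sum _ lf' lg') (linear_pred_sum (tmap_linear lf lg)) tmap_sum.
- by apply: eq_bigr => p _; rewrite tmap_pure.
- by move=> a u v; rewrite /= lf' lf.
- by move=> a u v; rewrite /= lg' lg.
Qed.

Lemma linear_mulr (a : H) : linear (fun h : H => h * a).
Proof. by move=> c u v; rewrite mulrDl scalerAl. Qed.

Lemma linear_bracketl y : linear (br^~ y).
Proof. by move=> c u v; rewrite linearPl. Qed.

Lemma bilin_coact_bracket x1 (h : H) :
  bilin (fun v t => br x1 v :⊗ (h * mul_antipode t)).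
Proof.
apply: (bilin_tpure (f := br x1) (g := fun t => h * mul_antipode t)).
  exact: linearP.
by move=> a u v; rewrite mul_antipode_linear mulrDr scalerAr.
Qed.

Lemma diag_coact_pure (V W : lmodType K) (rhoV : {linear V -> V ⊗ H})
    (rhoW : {linear W -> W ⊗ H}) (cV : V -> seq (V * H)) (cW : W -> seq (W * H)) x y :
  (forall v, rhoV v = pure_sum (cV v)) -> (forall w, rhoW w = pure_sum (cW w)) ->
  diag_coact rhoV rhoW (x :⊗ y) =
  \sum_(p <- cV x) \sum_(q <- cW y) (p.1 :⊗ q.1) :⊗ (p.2 * q.2).
Proof.
move=> VE WE.
have bi (x0 : V) (x1 : H) : bilin (fun (y0 : W) (y1 : H) => (x0 :⊗ y0) :⊗ (x1 * y1)).
  apply: (bilin_tpure (f := fun y0 => x0 :⊗ y0) (g := fun y1 => x1 * y1)) => c u v.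
    by rewrite tpureDr tpureZr.
  by rewrite mulrDr scalerAr.
have bG z : bilin (fun (x0 : V) (x1 : H) =>
    tlift (fun (y0 : W) (y1 : H) => (x0 :⊗ y0) :⊗ (x1 * y1)) (rhoW z)).
  split=> [x1|x0] c u v; rewrite WE !tlift_sum // scaler_sumr -big_split /=;
    apply: eq_bigr => p _.
    by rewrite tpureDl tpureZl tpureDl tpureZl.
  by rewrite mulrDl -scalerAl tpureDr tpureZr.
rewrite /diag_coact tlift_pure.
- rewrite VE tlift_sum //; apply: eq_bigr => p _.
  by rewrite WE tlift_sum.
- by move=> z c u v; rewrite linearP (tlift_linear (bG z)).
move=> w c u v; rewrite VE !tlift_sum // scaler_sumr -big_split /=; apply: eq_bigr => p _.
by rewrite linearP (tlift_linear (bi _ _)).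
Qed.

(** Coinvariance of the bracket expands the right-hand side to
    [x_(0), y_(0)] (x) x_(1) y_(1) S(y_(2)); the antipode and the counit
    collapse it. *)
Lemma coact_bracket (rho : {linear L -> L ⊗ H}) :
  is_right_comodule rho -> coinvariant_bracket br rho ->
  forall x y (s : seq (L * H)), rho y = pure_sum s ->
  tmap (br^~ y) id (rho x) =
  \sum_(p <- s) tmap id (fun h => h * antipode p.2) (rho (br x p.1)).
Proof.
move=> [rhoA rho1] inv x y s ys.
have bbr := bilin_bracket.
have [co coE] := choice (fun v : L => tens_sumP (rho v)).
have invE z : rho (br x z) =
    \sum_(p <- co x) \sum_(q <- co z) br p.1 q.1 :⊗ (p.2 * q.2).
  have := inv (x :⊗ z); rewrite (tlift_pure bbr.1 bbr.2) => ->.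
  have lbr : linear (tlift br) := tlift_linear bbr.
  rewrite (diag_coact_pure _ _ coE coE) (linear_pred_sum (tmap_linear lbr linear_id)).
  apply: eq_bigr => p _; rewrite (linear_pred_sum (tmap_linear lbr linear_id)).
  apply: eq_bigr => q _; rewrite (tmap_pure _ _ lbr linear_id).
  by rewrite (tlift_pure bbr.1 bbr.2).
rewrite coE -/(pure_sum _) tmap_sum //; last exact: linear_bracketl.
under [RHS]eq_bigr => p _.
  rewrite invE (linear_pred_sum (tmap_linear linear_id (linear_mulr _))).
  under eq_bigr => q _.
    rewrite (linear_pred_sum (tmap_linear linear_id (linear_mulr _))).
    under eq_bigr => r _ do rewrite (tmap_pure _ _ linear_id (linear_mulr _))
      -mulrA -mul_antipode_pure.
    over.
  over.
rewrite exchange_big /=; apply: eq_bigr => -[x1 h] _ /=.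
have bF := bilin_coact_bracket x1 h.
have := rhoA y; rewrite ys (tassoc_tmap_sum _ (linearP _) coE).
rewrite tmap_sum //; last exact: linearP.
move/(congr1 (tlift (fun v t => br x1 v :⊗ (h * mul_antipode t)))).
rewrite !(linear_pred_sum (tlift_linear bF)).
have inner p : \sum_(r <- co p.1) br x1 r.1 :⊗ (h * mul_antipode (r.2 :⊗ p.2)) =
    tlift (fun v t => br x1 v :⊗ (h * mul_antipode t))
      (\sum_(r <- co p.1) r.1 :⊗ (r.2 :⊗ p.2)).
  rewrite (linear_pred_sum (tlift_linear bF)); apply: eq_bigr => r _.
  by rewrite (tlift_pure bF.1 bF.2).
move=> E; rewrite (eq_bigr _ (fun p _ => inner p)) E.
under eq_bigr => p _ do rewrite (tlift_pure bF.1 bF.2)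
  [mul_antipode _]antipoder -scalerAr mulr1 tpureZr -tpureZl -linearZr_LR.
rewrite -tpure_suml -linear_sumr; congr (br x1 _ :⊗ h).
have := rho1 y; rewrite ys tlift_sum //.
split=> [b|v] c u w; first by rewrite scalerDr !scalerA mulrC.
by rewrite linearP scalerDl scalerA.
Qed.

End HopfTranslation.

(** * Invariance of the radical *)

Theorem corollary1p5 (K : fieldType) (charK : [pchar K] =i pred0)
    (H : hopfAlgType K) (L : vectType K) (br : {bilinear L -> L -> L})
    (brL : is_lie_bracket br) (N R : {vspace L})
    (hN : is_nilradical br N) (hR : is_solvable_radical br R) :
  (forall rho : {linear L -> L ⊗ H},
     is_right_comodule rho -> coinvariant_bracket br rho ->
     H_coinvariant rho N -> H_coinvariant rho R) /\
  (forall act : {bilinear H -> L -> L},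
     is_left_module act -> invariant_bracket br act ->
     H_invariant act N -> H_invariant act R).
Proof.
have memR := mem_solvable_radical brL charK hN hR.
split=> [rho rhoC inv invN w /memR Rw | act actM inv invN h x /memR Rx].
(* A projection with kernel N turns membership in N into a linear equation, so
   that R is the common kernel of the maps x |-> pi [x, e_i], e a basis of L. *)
- pose pi (x : L) := x - projv N x.
  have lpi : linear pi by move=> a u v; rewrite /pi linearP opprD addrACA scalerBr.
  have piN x : x \in N -> pi x = 0 by move=> Nx; rewrite /pi projv_id ?subrr.
  pose e (i : 'I_(\dim {:L})) : L := (vbasis {:L})`_i.
  have lbr := linear_bracketl br.
  apply: (tens_subvsP (f := fun i x => pi (br x (e i)))) => [i|x pix|i].
  + by move=> a u v; rewrite lbr lpi.
  + apply/memR=> y; rewrite (coord_vbasis (memvf y)) linear_sumr; apply: memv_suml => i _.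
    rewrite linearZr_LR memvZ //; move/eqP: (pix i); rewrite subr_eq0 => /eqP ->.
    exact: memv_proj.
  have [s sE] := tens_sumP (rho (e i)).
  transitivity (tmap pi id (tmap (br^~ (e i)) id (rho w))); first by rewrite tmap_comp.
  rewrite (coact_bracket rhoC inv _ sE) (linear_pred_sum (tmap_linear lpi linear_id)).
  rewrite big1 // => p _; have [t ->] := invN _ (Rw p.1).
  have lv : linear (vsval : subvs_of N -> L) by exact: linearP.
  have lm := linear_mulr (antipode p.2).
  rewrite (tmap_comp _ linear_id lm lv linear_id) tmap_comp //.
    have [q ->] := tens_sumP t; rewrite -/(pure_sum q) tmap_sum.
    + rewrite big1 // => r _ /=; rewrite piN ?subvsP // -(scale0r (0 : L)) tpureZl.
      by rewrite scale0r.
    + by move=> a u v; rewrite /= lpi.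
    + by move=> a u v; rewrite /= lm.
- have [s sE] := tens_sumP (comul h).
  apply/memR=> y; rewrite (act_bracket actM inv _ _ sE); apply: memv_suml => p _.
  exact/invN/Rx.
Qed.
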